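(* Let $F\in \mathrm{Mod}(\mathbf{k}_{\mathbb{V}_{\mathfrak{a}}})$. Then $F$ is ephemeral if and only if $\mathrm{Inter}(F,0)=\mathrm{Int}(\gamma^a)$.
   Context: $\mathbf{k}$ is a field and $\mathbb{V}$ is a finite dimensional real vector space. $\gamma\subset\mathbb{V}$ is a closed convex cone ($\mathbb{R}_{>0}\gamma\subset\gamma$) with non-empty interior, and is proper: $\gamma\cap(-\gamma)=\{0\}$. $\gamma^a=-\gamma$, and $\mathrm{Int}$ denotes the interior for the usual topology. $\mathbb{V}_\gamma$ is $\mathbb{V}$ with the $\gamma$-topology: the open sets are the subsets $U$ which are open for the usual topology and satisfy $U+\gamma=U$. $\mathbb{V}_{\mathfrak{a}}$ is $\mathbb{V}$ with the Alexandrov topology: the open sets are all subsets $U$ with $U+\gamma=U$. $\mathrm{Mod}(\mathbf{k}_{X})$ is the category of sheaves of $\mathbf{k}$-modules on $X$. $\beta\colon\mathbb{V}_{\mathfrak{a}}\to\mathbb{V}_\gamma$ is the identity map, which is continuous. A sheaf $F\in\mathrm{Mod}(\mathbf{k}_{\mathbb{V}_{\mathfrak{a}}})$ is ephemeral if $\beta_*F\simeq 0$, i.e. $F(U)=0$ for every $\gamma$-open set $U$. For $v\in\mathbb{V}$ let $\tau_v\colon x\mapsto x-v$, so that $(\tau_{v*}F)(U)=F(U+v)$. If $v\in\gamma^a$ then $U\subset U+v$ for every open $U$ of $\mathbb{V}_{\mathfrak a}$, and the restriction maps $F(U+v)\to F(U)$ define a natural morphism $\chi_{v,0}(F)\colon\tau_{v*}F\to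 F$. Sheaves $F,G$ are $v$-interleaved ($v\in\gamma^a$) if there are morphisms $f\colon\tau_{v*}F\to G$ and $g\colon\tau_{v*}G\to F$ with $g\circ\tau_{v*}f=\chi_{2v,0}(F)$ and $f\circ\tau_{v*}g=\chi_{2v,0}(G)$. $\mathrm{Inter}(F,G)=\{v\in\mathrm{Int}(\gamma^a)\mid F\text{ and }G\text{ are }v\text{-interleaved}\}$. *)

(* Defs.v *)
From HB Require Import structures.
From mathcomp Require Import all_boot all_order all_algebra.
From mathcomp Require Import all_classical all_reals topology normedtype convex.

Set Implicit Arguments.
Unset Strict Implicit.
Unset Printing Implicit Defensive.

Import Order.TTheory GRing.Theory Num.Theory.
Import numFieldNormedType.Exports.

Local Open Scope classical_set_scope.
Local Open Scope ring_scope.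

Record opens (X : topologicalType) := Opens {
  open_set :> set X;
  open_setP : open open_set }.

Definition opensI (X : topologicalType) (U W : opens X) : opens X :=
  Opens (openI (open_setP U) (open_setP W)).

Lemma opensIl (X : topologicalType) (U W : opens X) : opensI U W `<=` U.
Proof. exact: subIsetl. Qed.

Lemma opensIr (X : topologicalType) (U W : opens X) : opensI U W `<=` W.
Proof. exact: subIsetr. Qed.

(* [res] takes a proof of inclusion; the laws are stated for arbitrary such
   proofs, so restriction does not depend on the proof that is chosen. *)
Record presheaf (k : fieldType) (X : topologicalType) := Presheaf {
  sections :> opens X -> lmodType k;
  res : forall U W : opens X, W `<=` U -> {linear sections U -> sections W};
  res_id : forall (U : opens X) (h : U `<=` U) (s : sections U), res h s = s;
  res_comp : forall (U W Z : opens X) (hWU : W `<=` U) (hZW : Z `<=` W)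
      (hZU : Z `<=` U) (s : sections U),
    res hZW (res hWU s) = res hZU s }.

Definition is_sheaf (k : fieldType) (X : topologicalType) (F : presheaf k X) :=
  forall (I : Type) (U : opens X) (W : I -> opens X)
    (hW : forall i, W i `<=` U),
    U `<=` \bigcup_i W i ->
  forall s : forall i, F (W i),
    (forall i j,
      res F (@opensIl X (W i) (W j)) (s i) =
      res F (@opensIr X (W i) (W j)) (s j)) ->
  exists! t : F U, forall i, res F (hW i) t = s i.

Record sheaf (k : fieldType) (X : topologicalType) := Sheaf {
  sheaf_presheaf :> presheaf k X;
  sheafP : is_sheaf sheaf_presheaf }.

Record hom (k : fieldType) (X : topologicalType) (F G : presheaf k X) := Hom {
  hom_map :> forall U : opens X, {linear F U -> G U};
  hom_nat : forall (U W : opens X) (h : W `<=` U) (s : F U),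
    hom_map W (res F h s) = res G h (hom_map U s) }.

Definition hom_eq (k : fieldType) (X : topologicalType) (F G : presheaf k X)
    (f g : hom F G) := forall (U : opens X) (s : F U), f U s = g U s.

Section HomCategory.
Variables (k : fieldType) (X : topologicalType).
Implicit Types F G H : presheaf k X.

Definition hom_id F : hom F F :=
  @Hom k X F F (fun U => idfun : {linear F U -> F U}) (fun _ _ _ _ => erefl).

Definition hom_comp_map F G H (g : hom G H) (f : hom F G) (U : opens X) :
  {linear F U -> H U} := (g U \o f U : {linear F U -> H U}).

Lemma hom_comp_nat F G H (g : hom G H) (f : hom F G) (U W : opens X)
    (h : W `<=` U) (s : F U) :
  hom_comp_map g f W (res F h s) = res H h (hom_comp_map g f U s).
Proof. by rewrite /hom_comp_map /= !hom_nat. Qed.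

Definition hom_comp F G H (g : hom G H) (f : hom F G) : hom F H :=
  Hom (hom_comp_nat g f).

Definition isomorphic F G :=
  exists (f : hom F G) (g : hom G F),
    hom_eq (hom_comp g f) (hom_id F) /\ hom_eq (hom_comp f g) (hom_id G).

Definition zero_presheaf : presheaf k X :=
  @Presheaf k X (fun _ => 'rV[k]_0)
    (fun _ _ _ => idfun : {linear 'rV[k]_0 -> 'rV[k]_0})
    (fun _ _ _ => erefl) (fun _ _ _ _ _ _ _ => erefl).

Lemma zero_is_sheaf : is_sheaf zero_presheaf.
Proof.
move=> I U W hW _ s _; exists 0; split=> [i|t _]; first by rewrite !thinmx0.
by rewrite [t]thinmx0.
Qed.

Definition zero_sheaf : sheaf k X := Sheaf zero_is_sheaf.

End HomCategory.

Section DirectImage.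
Variables (k : fieldType) (X Y : topologicalType) (f : X -> Y).
Hypothesis cf : continuous f.

Definition preimage_open (U : opens Y) : opens X :=
  Opens ((continuousP f).1 cf U (open_setP U)).

Lemma preimage_openS (U W : opens Y) :
  W `<=` U -> preimage_open W `<=` preimage_open U.
Proof. exact: preimage_subset. Qed.

Definition direct_image_presheaf (F : presheaf k X) : presheaf k Y :=
  @Presheaf k Y (fun U => F (preimage_open U))
    (fun U W h => res F (preimage_openS h))
    (fun U h s => res_id _ s)
    (fun U W Z h1 h2 h3 s => res_comp _ _ _ s).

Lemma direct_image_is_sheaf (F : sheaf k X) :
  is_sheaf (direct_image_presheaf F).
Proof.
move=> I U W hW cU s cs.
have cU' : preimage_open U `<=` \bigcup_i preimage_open (W i).
  by move=> x /cU [i _ Wi]; exists i.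
have [|t [tP tU]] :=
    @sheafP _ _ F I _ _ (fun i => preimage_openS (hW i)) cU' s.
  move=> i j.
  have hBA : opensI (preimage_open (W i)) (preimage_open (W j)) `<=`
      preimage_open (opensI (W i) (W j)) by [].
  have /(congr1 (res F hBA)) := cs i j.
  by rewrite (res_comp _ _ (@opensIl _ _ _)) (res_comp _ _ (@opensIr _ _ _)).
by exists t.
Qed.

Definition direct_image (F : sheaf k X) : sheaf k Y :=
  Sheaf (@direct_image_is_sheaf F).

Definition direct_image_hom (F G : sheaf k X) (u : hom F G) :
    hom (direct_image F) (direct_image G) :=
  @Hom k Y (direct_image F) (direct_image G) (fun U => u (preimage_open U))
    (fun U W h s => hom_nat u (preimage_openS h) s).

End DirectImage.

(* The usual topology of a finite dimensional real vector space: the one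
   transported from 'rV[R]_n by the coordinates in a basis. *)
Definition usual (R : realType) (V : vectType R) : topologicalType :=
  initial_topology (passmx.rVof (vbasis {:V}) : V -> 'rV[R]_(\dim {:V})).

Definition Int (R : realType) (V : vectType R) (A : set V) : set V :=
  @interior (usual V) A.

(* gamma^a *)
Definition antipodal (R : realType) (V : vectType R) (A : set V) : set V :=
  [set - x | x in A].

Definition minkowski_sum (R : realType) (V : vectType R) (A B : set V) : set V :=
  [set x + y | x in A & y in B].

Record proper_cone (R : realType) (V : vectType R) := ProperCone {
  cone_set :> set V;
  cone_closed : closed (cone_set : set (usual V));
  cone_convex : convex_set (cone_set : set (convex_lmodType V));
  cone_scale : forall (t : R) (x : V), 0 < t -> cone_set x -> cone_set (t *: x);
  cone_int : Int cone_set !=set0;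
  cone_proper : cone_set `&` antipodal cone_set = [set 0] }.

Lemma cone0 (R : realType) (V : vectType R) (gamma : proper_cone V) : cone_set gamma 0.
Proof.
have : [set 0 : V] 0 by [].
by rewrite -(cone_proper gamma) => -[].
Qed.

Section StableSets.
Variables (R : realType) (V : vectType R) (gamma : proper_cone V).
Implicit Types A B : set V.

Lemma minkowski_coneP A :
  minkowski_sum A gamma = A <-> forall x y, A x -> cone_set gamma y -> A (x + y).
Proof.
split=> [AE x y Ax gy|H]; first by rewrite -AE; exists x => //; exists y.
apply/seteqP; split=> [_ [x Ax [y gy <-]]|x Ax]; first exact: H.
by exists x => //; exists 0; [exact: cone0|rewrite addr0].
Qed.

Lemma minkowski_coneT : minkowski_sum setT gamma = setT.
Proof. exact/minkowski_coneP. Qed.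

Lemma minkowski_coneI A B : minkowski_sum A gamma = A ->
  minkowski_sum B gamma = B -> minkowski_sum (A `&` B) gamma = A `&` B.
Proof.
move=> /minkowski_coneP hA /minkowski_coneP hB; apply/minkowski_coneP.
by move=> x y [Ax Bx] gy; split; [exact: hA|exact: hB].
Qed.

Lemma minkowski_cone_bigcup (I : Type) (f : I -> set V) :
  (forall i, minkowski_sum (f i) gamma = f i) ->
  minkowski_sum (\bigcup_i f i) gamma = \bigcup_i f i.
Proof.
move=> hf; apply/minkowski_coneP => x y [i _ fx] gy; exists i => //.
by move/minkowski_coneP: (hf i); apply.
Qed.

End StableSets.

Definition alexandrov (R : realType) (V : vectType R) (gamma : proper_cone V)
  : Type := V.
Definition gamma_space (R : realType) (V : vectType R) (gamma : proper_cone V)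
  : Type := V.

Section Topologies.
Variables (R : realType) (V : vectType R) (gamma : proper_cone V).

Definition alexandrov_open (U : set V) : Prop := minkowski_sum U gamma = U.

Definition gamma_open (U : set V) : Prop :=
  @open (usual V) U /\ minkowski_sum U gamma = U.

Lemma gamma_openT : gamma_open setT.
Proof. by split; [exact: openT|exact: minkowski_coneT]. Qed.

Lemma gamma_openI : setI_closed gamma_open.
Proof.
move=> A B [oA gA] [oB gB]; split; first exact: openI.
exact: minkowski_coneI.
Qed.

Lemma gamma_open_bigcup (I : Type) (f : I -> set V) :
  (forall i, gamma_open (f i)) -> gamma_open (\bigcup_i f i).
Proof.
move=> hf; split; first by apply: bigcup_open => i _; have [] := hf i.
by apply: minkowski_cone_bigcup => i; have [] := hf i.
Qed.

HB.instance Definition _ := Choice.copy (alexandrov gamma) V.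
HB.instance Definition _ := @isOpenTopological.Build (alexandrov gamma)
  alexandrov_open (minkowski_coneT gamma) (@minkowski_coneI _ _ gamma)
  (@minkowski_cone_bigcup _ _ gamma).

HB.instance Definition _ := Choice.copy (gamma_space gamma) V.
HB.instance Definition _ := @isOpenTopological.Build (gamma_space gamma)
  gamma_open gamma_openT gamma_openI gamma_open_bigcup.

Definition beta : alexandrov gamma -> gamma_space gamma := fun x => x.

Lemma beta_continuous : continuous beta.
Proof. by apply/continuousP => A [_ gA]. Qed.

Definition tau (v : V) : alexandrov gamma -> alexandrov gamma :=
  fun x : V => x - v.

Lemma tau_continuous (v : V) : continuous (tau v).
Proof.
apply/continuousP => A /minkowski_coneP gA; apply/minkowski_coneP.
by move=> x y Ax gy; rewrite /tau /preimage /= addrAC; exact: gA.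
Qed.

End Topologies.

Section Interleaving.
Variables (R : realType) (V : vectType R) (gamma : proper_cone V).
Variable k : fieldType.
Local Notation Va := (alexandrov gamma).
Implicit Types F G : sheaf k Va.

Definition ephemeral F : Prop :=
  isomorphic (direct_image (@beta_continuous R V gamma) F) (zero_sheaf k _).

Definition tau_direct (v : V) F : sheaf k Va :=
  direct_image (@tau_continuous R V gamma v) F.

Definition tau_direct_hom (v : V) F G (u : hom F G) :
    hom (tau_direct v F) (tau_direct v G) :=
  direct_image_hom (@tau_continuous R V gamma v) u.

Lemma chi_subset (v : V) (hv : antipodal gamma v) (U : opens Va) :
  U `<=` preimage_open (@tau_continuous R V gamma v) U.
Proof.
case: hv => y gy <- x Ux; rewrite /preimage /= /tau opprK.
by have /minkowski_coneP := open_setP U; apply.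
Qed.

Lemma chi_nat (v : V) (hv : antipodal gamma v) F (U W : opens Va)
    (h : W `<=` U) (s : tau_direct v F U) :
  res F (chi_subset hv (U := W)) (res (tau_direct v F) h s) =
  res F h (res F (chi_subset hv (U := U)) s).
Proof.
have hWU := subset_trans h (chi_subset hv (U := U)).
by rewrite /= (res_comp _ _ hWU) (res_comp _ _ hWU).
Qed.

(* chi_{v,0}(F) *)
Definition chi (v : V) (hv : antipodal gamma v) F : hom (tau_direct v F) F :=
  @Hom k Va (tau_direct v F) F (fun U => res F (chi_subset hv (U := U)))
    (fun U W h s => chi_nat hv h s).

(* The opens (U + v) + v and U + 2v are equal but not convertible, so the
   identification of tau_v* tau_v* with tau_2v* is made explicit: it is the
   restriction along that equality. *)
Lemma tau_tau_subset (v : V) (U : opens Va) :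
  preimage_open (@tau_continuous R V gamma (v *+ 2)) U `<=`
  preimage_open (@tau_continuous R V gamma v)
    (preimage_open (@tau_continuous R V gamma v) U).
Proof. by move=> x; rewrite /preimage /= /tau mulr2n opprD addrA. Qed.

Lemma tau_tau_nat (v : V) F (U W : opens Va) (h : W `<=` U)
    (s : tau_direct v (tau_direct v F) U) :
  res F (@tau_tau_subset v W) (res (tau_direct v (tau_direct v F)) h s) =
  res (tau_direct (v *+ 2) F) h (res F (@tau_tau_subset v U) s).
Proof.
pose cv := @tau_continuous R V gamma v.
have hWU := subset_trans (@tau_tau_subset v W)
  (preimage_openS (cf := cv) (preimage_openS (cf := cv) h)).
by rewrite /= (res_comp _ _ hWU) (res_comp _ _ hWU).
Qed.

Definition tau_tau (v : V) F :
    hom (tau_direct v (tau_direct v F)) (tau_direct (v *+ 2) F) :=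
  @Hom k Va (tau_direct v (tau_direct v F)) (tau_direct (v *+ 2) F)
    (fun U => res F (@tau_tau_subset v U)) (fun U W h s => tau_tau_nat h s).

Lemma antipodal_double (v : V) :
  antipodal gamma v -> antipodal gamma (v *+ 2).
Proof.
move=> [y gy <-]; exists (y *+ 2); last by rewrite mulNrn.
by rewrite -scaler_nat; apply: cone_scale; rewrite ?ltr0n.
Qed.

Definition interleaved (v : V) (hv : antipodal gamma v) F G : Prop :=
  exists (f : hom (tau_direct v F) G) (g : hom (tau_direct v G) F),
    hom_eq (hom_comp g (tau_direct_hom v f))
           (hom_comp (chi (antipodal_double hv) F) (tau_tau v F)) /\
    hom_eq (hom_comp f (tau_direct_hom v g))
           (hom_comp (chi (antipodal_double hv) G) (tau_tau v G)).

Lemma Int_subset (A : set V) : Int A `<=` A.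
Proof. exact: (@interior_subset (usual V)). Qed.

Definition Inter F G : set V :=
  [set v | exists hv : Int (antipodal gamma) v,
    interleaved (Int_subset hv) F G].

End Interleaving.

(* Main.v *)
Require Import Defs.
From mathcomp Require Import all_boot all_order all_algebra.
From mathcomp Require Import all_classical all_reals topology normedtype.

Set Implicit Arguments.
Unset Strict Implicit.
Unset Printing Implicit Defensive.

Import Order.TTheory GRing.Theory Num.Theory.
Import numFieldNormedType.Exports.
Local Open Scope classical_set_scope.
Local Open Scope ring_scope.

(** An interleaving of F with 0 factors the restriction maps
    F(U + 2v) -> F(U) through 0, so v lies in Inter(F, 0) exactly when all
    these maps vanish ([interleaved_zeroP]); and F is ephemeral exactly when it
    has no nonzero section over a set that is open for the usual topology
    ([ephemeralP]). Two geometric facts relate these conditions.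

    If v is interior to the antipodal cone and U is stable under gamma, then U
    lies in the interior of U + v, which is again stable under gamma
    ([sub_Int_shift], [Int_cone_stable]). So F(U + 2v) -> F(U) factors through
    the sections over a gamma-open set, and it is zero when F is ephemeral.

    Conversely, a gamma-open set U is the union of its subsets U - 2v for v
    interior to the antipodal cone, since such v exist arbitrarily close to 0
    ([shift_cover]). A section over U restricts to U - 2v through the map
    F((U - 2v) + 2v) -> F(U - 2v). If these maps all vanish, the section is
    locally zero, hence zero. *)

Section UsualTopology.
Variables (R : realType) (V : vectType R).
Local Notation rV := (passmx.rVof (vbasis {:V})).

Lemma usual_affine_continuous (a : R) (b : V) :
  continuous ((fun x : V => a *: x + b) : usual V -> usual V).
Proof.
apply: continuous_comp_initial => x.
rewrite (_ : _ \o _ = fun y : usual V => a *: rV y + rV b); last first.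
  by apply/funext => y; exact: passmx.rVof_linear.
have Fx := @nbhs_filter (usual V) x.
apply: cvgD; last exact: cvg_cst.
by apply: cvgZl_tmp; exact: initial_continuous.
Qed.

Lemma usual_line_continuous (w b : V) :
  continuous ((fun t : R => t *: w + b) : R -> usual V).
Proof.
apply: continuous_comp_initial => x.
rewrite (_ : _ \o _ = fun t : R => t *: rV w + rV b); last first.
  by apply/funext => t; exact: passmx.rVof_linear.
apply: cvgD; last exact: cvg_cst.
by apply: cvgZr_tmp; exact: cvg_id.
Qed.

(** Neighbourhoods pull back along affine maps; translations and homotheties
    thus preserve interiors. *)
Lemma Int_affine (a : R) (b : V) (A B : set V) (x : V) :
  (forall y, A (a *: y + b) -> B y) -> Int A (a *: x + b) -> Int B x.
Proof.
move=> AB Ax; apply: (@filterS _ _ (@nbhs_filter (usual V) x) _ _ AB).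
exact: (@usual_affine_continuous a b x _ Ax).
Qed.

End UsualTopology.

Section Cone.
Variables (R : realType) (V : vectType R) (gamma : proper_cone V).
Implicit Types (v x y : V) (U : opens (alexandrov gamma)).

Lemma antipodalE v : antipodal gamma v <-> cone_set gamma (- v).
Proof.
by split=> [[y gy <-]|gv]; [rewrite opprK | exists (- v); rewrite ?opprK].
Qed.

Lemma opens_cone U x y : open_set U x -> cone_set gamma y -> open_set U (x + y).
Proof. by have /minkowski_coneP := open_setP U; apply. Qed.

Lemma Int_antipodal_scale (t : R) v :
  0 < t -> Int (antipodal gamma) v -> Int (antipodal gamma) (t *: v).
Proof.
move=> t0 Iv; apply: (@Int_affine _ _ t^-1 0 (antipodal gamma)).
  move=> y; rewrite addr0 => /antipodalE gy; apply/antipodalE.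
  have := cone_scale t0 gy.
  by rewrite scalerN scalerA mulfV ?gt_eqF // scale1r.
by rewrite addr0 scalerA mulVf ?gt_eqF // scale1r.
Qed.

Lemma Int_antipodal_neq0 : Int (antipodal gamma) !=set0.
Proof.
have [w Iw] := cone_int gamma; exists (- w).
apply: (@Int_affine _ _ (- 1) 0 gamma).
  by move=> y; rewrite addr0 scaleN1r => /antipodalE.
by rewrite addr0 scaleN1r opprK.
Qed.

Lemma Int_cone_stable U : alexandrov_open gamma (Int U).
Proof.
apply/minkowski_coneP => x y Ix gy.
apply: (@Int_affine _ _ 1 (- y) U).
  move=> z; rewrite scale1r => Uz.
  by rewrite -(subrK y z); apply: opens_cone.
by rewrite scale1r addrK.
Qed.

(** If v is interior to the antipodal cone, then every x in U has the
    neighbourhood x + v + gamma, which is contained in U + v. *)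
Lemma sub_Int_shift U v : Int (antipodal gamma) v ->
  U `<=` Int (preimage_open (@tau_continuous R V gamma v) U).
Proof.
move=> Iv x Ux.
apply: (@Int_affine _ _ (- 1) (x + v) (antipodal gamma)).
  move=> z /antipodalE gz; rewrite /preimage /= /tau.
  suff -> : (z : V) - v = x + - (-1 *: z + (x + v)) by exact: opens_cone.
  by rewrite scaleN1r !opprD opprK addrCA addNKr.
by rewrite scaleN1r addKr.
Qed.

(** Follow the ray from x in the direction of a fixed interior point of the
    antipodal cone: it stays in the open set U for a short time. *)
Lemma shift_cover U x : @open (usual V) U -> open_set U x ->
  exists2 v, Int (antipodal gamma) v & open_set U (x + v).
Proof.
move=> oU Ux; have [w Iw] := Int_antipodal_neq0.
have : \forall t \near (0 : R), open_set U (t *: w + x).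
  apply: (@usual_line_continuous _ _ w x 0).
  by rewrite scale0r add0r; exact: open_nbhs_nbhs.
move=> /nbhs_ballP[e /= e0 eU].
exists ((e / 2) *: w); first by apply: Int_antipodal_scale; rewrite ?divr_gt0.
rewrite addrC; apply: eU; rewrite /ball /= sub0r normrN gtr0_norm ?divr_gt0 //.
by rewrite ltr_pdivrMr // ltr_pMr // ltr1n.
Qed.

End Cone.

Section Vanishing.
Variables (k : fieldType) (X : topologicalType).

Lemma res_factor0 (F : presheaf k X) (U Z W : opens X) (hWU : W `<=` U)
    (s : F U) : W `<=` Z -> Z `<=` U -> (forall t : F Z, t = 0) ->
  res F hWU s = 0.
Proof.
move=> hWZ hZU F0.
by rewrite -(res_comp hZU hWZ hWU) (F0 (res F hZU s)) linear0.
Qed.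

Lemma sheaf_locally0 (F : sheaf k X) (I : Type) (U : opens X)
    (W : I -> opens X) (hW : forall i, W i `<=` U) (s : F U) :
  U `<=` \bigcup_i W i -> (forall i, res F (hW i) s = 0) -> s = 0.
Proof.
move=> cU s0.
have [|t [_ tU]] := @sheafP _ _ F I U W hW cU (fun i => 0).
  by move=> i j; rewrite !linear0.
rewrite -(tU _ s0); apply: tU => i; exact: linear0.
Qed.

Definition zero_hom (F G : presheaf k X) : Defs.hom F G :=
  @Defs.Hom k X F G (fun U => (\0 : {linear F U -> G U}))
    (fun U W h s => esym (linear0 (res G h))).

Lemma isomorphic_zeroP (F : presheaf k X) :
  isomorphic F (zero_presheaf k X) <-> forall (U : opens X) (s : F U), s = 0.
Proof.
split=> [[f [g [gf _]]] U s|F0].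
  have <- : g U (f U s) = s := gf U s.
  by rewrite [f U s]thinmx0 linear0.
exists (zero_hom F _), (zero_hom _ F); split=> U s; first by rewrite (F0 U s) linear0.
by rewrite [LHS]thinmx0 [RHS]thinmx0.
Qed.

End Vanishing.

Section Interleaving.
Variables (R : realType) (V : vectType R) (gamma : proper_cone V).
Variables (k : fieldType) (F : sheaf k (alexandrov gamma)).
Implicit Type v : V.

(** The open sets of the Alexandrov topology are already stable under gamma, so
    openness for the usual topology is all that singles out the gamma-open
    ones. *)
Lemma ephemeralP : ephemeral F <->
  forall U : opens (alexandrov gamma), @open (usual V) U ->
  forall s : F U, s = 0.
Proof.
split=> [/isomorphic_zeroP F0 U oU s|F0].
  have oU' : open (U : set (gamma_space gamma)) by split; last exact: (open_setP U).
  rewrite -(res_id (fun x Ux => Ux) s).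
  pose bU := preimage_open (@beta_continuous R V gamma) (Opens oU').
  by apply: (res_factor0 (Z := bU)) => // t; exact: (F0 (Opens oU') t).
apply/isomorphic_zeroP => U s; apply: F0; exact: (open_setP U).1.
Qed.

(** Both composites of morphisms to and from 0 are zero, so the interleaving
    equation for F says that the restriction map chi is zero after the
    identification [tau_tau], and the equation for 0 is void. *)
Lemma interleaved_zeroP v (hv : antipodal gamma v) :
  interleaved hv F (zero_sheaf k (alexandrov gamma)) <->
  forall U (s : tau_direct (v *+ 2) F U), chi (antipodal_double hv) F U s = 0.
Proof.
split=> [[f [g [gf _]]] U s|chi0].
  (* The restriction along h inverts [tau_tau]. *)
  pose cv := @tau_continuous R V gamma v.
  have h : preimage_open cv (preimage_open cv U) `<=`
      preimage_open (@tau_continuous R V gamma (v *+ 2)) U.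
    by move=> x; rewrite /preimage /= /tau mulr2n opprD addrA.
  have := gf U (res F h s).
  rewrite /= [f _ _]thinmx0 linear0 (res_comp _ _ (fun x Ux => Ux)) res_id.
  exact: esym.
exists (zero_hom _ _), (zero_hom _ _); split=> U s; last by rewrite [LHS]thinmx0 [RHS]thinmx0.
exact: esym (chi0 _ _).
Qed.

End Interleaving.

Theorem proposition4p15 (R : realType) (V : vectType R) (gamma : proper_cone V)
    (k : fieldType) (F : sheaf k (alexandrov gamma)) :
  ephemeral F <-> Inter F (zero_sheaf k (alexandrov gamma)) = Int (antipodal gamma).
Proof.
split=> [/ephemeralP F0|IE].
  apply/seteqP; split=> [v []//|v Iv]; exists Iv.
  apply/interleaved_zeroP => U s.
  have I2v : Int (antipodal gamma) (v *+ 2).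
    by rewrite -scaler_nat; apply: Int_antipodal_scale; rewrite ?ltr0n.
  pose U2v := preimage_open (@tau_continuous R V gamma (v *+ 2)) U.
  have oI : open (Int U2v : set (alexandrov gamma)) := Int_cone_stable U2v.
  apply: (res_factor0 (Z := Opens oI)).
  - exact: sub_Int_shift.
  - exact: Int_subset.
  - by apply: F0; exact: (@open_interior (usual V)).
apply/ephemeralP => U oU s.
pose W (v : {v : V | Int (antipodal gamma) v}) :=
  preimage_open (@tau_continuous R V gamma (- (sval v *+ 2))) U.
have hW v : W v `<=` U.
  case: v => v Iv x; rewrite /W /preimage /= /tau opprK => Ux.
  rewrite -(addrK (v *+ 2) (x : V)); apply: opens_cone => //.
  by apply/antipodalE; apply: antipodal_double; exact: Int_subset Iv.
apply: (sheaf_locally0 (hW := hW)) => [x Ux|[v Iv]].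
  (* W v is U - 2v, so covering x requires half of the shift. *)
  have [v Iv Uxv] := shift_cover oU Ux.
  have Iv2 : Int (antipodal gamma) (2^-1 *: v).
    by apply: Int_antipodal_scale; rewrite ?invr_gt0 ?ltr0n.
  exists (exist _ _ Iv2) => //; rewrite /W /preimage /= /tau opprK.
  by rewrite -scaler_nat scalerA mulfV ?pnatr_eq0 // scale1r.
have : Inter F (zero_sheaf k _) v by rewrite IE.
move=> [hv /interleaved_zeroP chi0].
(* (U - 2v) + 2v is U, so s is a section over it. *)
have h : preimage_open (@tau_continuous R V gamma (v *+ 2)) (W (exist _ v Iv))
    `<=` U.
  by move=> x; rewrite /W /preimage /= /tau opprK subrK.
have := chi0 _ (res F h s); rewrite /= (res_comp _ _ (hW (exist _ v Iv))).
exact.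
Qed.
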